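(* Let $n$ be a fixed number of nodes and $1\le m<n$. Consider steady states on the cycle graph with $n$ nodes of the Gierer–Meinhardt system with $D_u=\varepsilon^2$, $D_v=\kappa\varepsilon^2$, i.e. solutions of $$0=\varepsilon^2\mathcal L u-u+\frac{u^2}{v},\qquad 0=\kappa\varepsilon^2\mathcal L v-v+u^2,$$ in the limit $\varepsilon\to0$ with $\kappa>0$ fixed. (i) If $\kappa>4$, there exists (for all sufficiently small $\varepsilon>0$) a stable $m$-mesa solution, whose leading-order approximation as $\varepsilon\to0$ is $$v(k)\sim\begin{cases}1,&k\le m,\\(\kappa\varepsilon^2)^{k-m},&m<k<\lceil (n-m)/2\rceil,\end{cases}\qquad u(k)\sim\begin{cases}1,&k\le m,\\ \eta_{k-m}\,v(k),&m<k<\lceil (n-m)/2\rceil,\end{cases}$$ where the coefficients $\eta$ are given by the recursion $$\eta_k=\frac{1-\sqrt{1-4\eta_{k-1}/\kappa}}{2},$$ with starting value $1$ on the mesa (that is, with $\eta_{0}=1$ at the node $k=m$, so that $\eta_1=\frac{1-\sqrt{1-4/\kappa}}2$ at the node $k=m+1$). (ii) If $\kappa<4$, no solution exists with $u(k)\sim1$ and $u(k+1)\sim0$ for some node $k$.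
   Context: Nodes are $k\in\{1,\dots,n\}$ taken modulo $n$, and $(\mathcal L u)(k)=u(k+1)+u(k-1)-2u(k)$. An $m$-mesa solution is a family of steady states (with $v>0$), indexed by small $\varepsilon>0$, with $u(k),v(k)\to1$ at the $m$ consecutive nodes $k=1,\dots,m$ and $u(k),v(k)\to0$ at all other nodes as $\varepsilon\to0$; for $m=1$ it is a one-spike solution. Here $f\sim g$ (for $g\ne0$) means $f/g\to1$ as $\varepsilon\to0$; in (ii), $u(k)\sim1$ and $u(k+1)\sim0$ mean that along a family of steady states with $\varepsilon\to0$, $u$ and $v$ converge to $1$ at node $k$ and to $0$ at node $k+1$; in the paper such solutions are expansions in powers of $\varepsilon^2$, $u=u_0+\varepsilon^2u_1+\cdots$, $v=v_0+\varepsilon^2v_1+\cdots$. Stability is linear stability for the time-dependent system $u_t=\varepsilon^2\mathcal L u-u+u^2/v$, $0=\kappa\varepsilon^2\mathcal L v-v+u^2$: every $\lambda\in\mathbb C$ for which there is $(\phi,\psi)\ne(0,0)$ with $$\lambda\phi=\varepsilon^2\mathcal L\phi-\phi+\frac{2u}{v}\phi-\frac{u^2}{v^2}\psi,\qquad 0=\kappa\varepsilon^2\mathcal L\psi-\psi+2u\phi$$ has negative real part. *)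

(* Defs.v *)
From HB Require Import structures.
From mathcomp Require Import all_boot all_order all_algebra.
From mathcomp Require Import all_classical all_reals all_analysis.
From mathcomp Require Import complex.
Set Implicit Arguments.
Unset Strict Implicit.
Unset Printing Implicit Defensive.
Import Order.TTheory GRing.Theory Num.Theory.
Import numFieldNormedType.Exports.
Local Open Scope classical_set_scope.
Local Open Scope ring_scope.
Local Open Scope complex_scope.

(* The node set {1, ..., n} modulo n is the type 'I_n; the ordinal i stands
   for the node numbered i + 1, and ordS / ord_pred are the cyclic successor
   and predecessor. *)
Definition node (n : nat) (k : 'I_n) : nat := k.+1.

(* Coefficients in an arbitrary ring, so that it applies both to real steady
   states and to complex eigenfunctions. For n = 2 the two neighbours of a
   node coincide and are counted twice, as the modular formula prescribes. *)
Definition lap (A : pzRingType) (n : nat) (u : 'I_n -> A) (k : 'I_n) : A :=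
  u (ordS k) + u (ord_pred k) - 2 * u k.

(* v k != 0 is what gives the quotient u^2/v its meaning, as x / 0 = 0 here. *)
Definition steady_state (R : realType) (n : nat) (kappa eps : R)
    (u v : 'I_n -> R) : Prop :=
  forall k : 'I_n,
    [/\ v k != 0,
        0 = eps ^+ 2 * lap u k - u k + u k ^+ 2 / v k &
        0 = kappa * eps ^+ 2 * lap v k - v k + u k ^+ 2].

Definition lin_eigenvalue (R : realType) (n : nat) (kappa eps : R)
    (u v : 'I_n -> R) (lambda : R[i]) : Prop :=
  exists phi psi : 'I_n -> R[i],
    (exists k : 'I_n, phi k != 0 \/ psi k != 0) /\
    forall k : 'I_n,
      lambda * phi k =
        (eps ^+ 2)%:C * lap phi k - phi k + (2 * u k / v k)%:C * phi k
        - (u k ^+ 2 / v k ^+ 2)%:C * psi k /\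
      0 = (kappa * eps ^+ 2)%:C * lap psi k - psi k + (2 * u k)%:C * phi k.

Definition linearly_stable (R : realType) (n : nat) (kappa eps : R)
    (u v : 'I_n -> R) : Prop :=
  forall lambda : R[i],
    lin_eigenvalue kappa eps u v lambda -> complex.Re lambda < 0.

(* U eps, V eps are the values of the family at the parameter eps; only small
   eps > 0 matter. *)
Definition mesa_solution (R : realType) (n m : nat) (kappa : R)
    (U V : R -> 'I_n -> R) : Prop :=
  [/\ (\forall eps \near 0^'+, steady_state kappa eps (U eps) (V eps) /\
                               forall k : 'I_n, 0 < V eps k),
      (forall k : 'I_n, (node k <= m)%N ->
         (U eps k @[eps --> 0^'+] --> (1 : R)) /\
         (V eps k @[eps --> 0^'+] --> (1 : R))) &
      (forall k : 'I_n, (m < node k)%N ->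
         (U eps k @[eps --> 0^'+] --> (0 : R)) /\
         (V eps k @[eps --> 0^'+] --> (0 : R)))].

Definition asymp (R : realType) (f g : R -> R) : Prop :=
  f eps / g eps @[eps --> 0^'+] --> (1 : R).

Fixpoint eta_coef (R : realType) (kappa : R) (j : nat) : R :=
  if j is i.+1 then (1 - Num.sqrt (1 - 4 * eta_coef kappa i / kappa)) / 2 else 1.

(* uphalf p is the ceiling of p / 2. *)
Definition mesa_leading_order (R : realType) (n m : nat) (kappa : R)
    (U V : R -> 'I_n -> R) : Prop :=
  forall k : 'I_n,
    ((node k <= m)%N ->
       asymp (fun eps => V eps k) (fun=> 1) /\
       asymp (fun eps => U eps k) (fun=> 1)) /\
    ((m < node k < uphalf (n - m))%N ->
       asymp (fun eps => V eps k)
             (fun eps => (kappa * eps ^+ 2) ^+ (node k - m)) /\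
       asymp (fun eps => U eps k)
             (fun eps => eta_coef kappa (node k - m) * V eps k)).

(* A family of steady states along which eps tends to 0 is given by an
   arbitrary sequence of positive parameters tending to 0, with no regularity
   required in eps; in particular expansions in powers of eps^2 are covered. *)
Definition jump_solution (R : realType) (n : nat) (kappa : R) (k : 'I_n) :
    Prop :=
  exists (eps : nat -> R) (U V : nat -> 'I_n -> R),
    [/\ (forall j, 0 < eps j) /\ (eps j @[j --> \oo] --> (0 : R)),
        (forall j, steady_state kappa (eps j) (U j) (V j)),
        (U j k @[j --> \oo] --> (1 : R)) /\
        (V j k @[j --> \oo] --> (1 : R)) &
        (U j (ordS k) @[j --> \oo] --> (0 : R)) /\
        (V j (ordS k) @[j --> \oo] --> (0 : R))].

(* Main.v *)
Require Import Defs.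
From HB Require Import structures.
From mathcomp Require Import all_boot all_order all_algebra.
From mathcomp Require Import all_classical all_reals all_analysis.
From mathcomp Require Import complex.
From mathcomp Require Import ring lra zify.
Set Implicit Arguments.
Unset Strict Implicit.
Unset Printing Implicit Defensive.
Import Order.TTheory GRing.Theory Num.Theory.
Import numFieldNormedType.Exports.
Local Open Scope classical_set_scope.
Local Open Scope ring_scope.

(** Part (i), existence. Put [d = eps ^+ 2] and let [mesa_dist k] be the number
    of steps from the node [k] to the mesa. In the unknowns
    [u k = d ^+ mesa_dist k * X k] and [v k = d ^+ mesa_dist k * Y k] the
    steady-state equations become, after division by powers of [d], polynomial
    equations that still make sense at [d = 0] ([rescaled_steady]). There a node
    feels only its neighbours one step closer to the mesa, so the limit system
    is solved layer by layer: [Y] is [kappa ^+ mesa_dist k] times the number of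
    shortest paths from the mesa, and [X / Y] solves the quadratic equation
    [x ^+ 2 - x + eta_coef kappa j / kappa = 0] whose smaller root is
    [eta_coef kappa j.+1]. The linearization at this solution is triangular with
    respect to the distance, with nonzero diagonal because
    [eta_coef kappa j.+1 < 1 / 2] when [kappa > 4] ([rescaled_lin_inj]). The
    implicit function theorem [strict_implicit_function] then continues the
    solution to small [d] ([mesa_branch]); its continuity at [d = 0] is the
    leading-order statement.

    Part (i), stability. For an eigenpair, let [k] be the node where [|phi k|]
    is largest. The maximum principle bounds [psi] by [phi], so the two equations
    at [k] show that [lambda] is within [O(d)] of [-1 + 2 w - 2 w ^+ 2 u], where
    [w = u k / v k] ([lin_eigenvalue_bound]). This number tends to [-1] on the
    mesa and to [-1 + 2 eta < 0] off the mesa, whence stability.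

    Part (ii). The maximum principle gives [v > 0] and
    [0 <= u <= 1 + 2 kappa d] for every steady state. At the node [p] following
    the jump the equation for [u] is a quadratic with a real root, so its
    discriminant is nonnegative:
    [4 d (sum of u over the neighbours) <= (1 + 2 d) ^+ 2 * v p]. The equation
    for [v] gives [v p <= kappa d (sum of v over the neighbours) + o(d)], and up
    to [o(1)] the sum of [v] is at most that of [u], which stays away from [0].
    In the limit [4 <= kappa] ([steady_jump_bound]). *)

(** * Strict differentiability and the implicit function theorem *)

(** Matrix spaces, being complete and normed, are complete normed modules: the
    setting of the Banach fixed-point theorem. *)
HB.instance Definition _ (R : realType) (p q : nat) := Complete.on 'M[R]_(p, q).

Section StrictDifferentiability.
Variables (R : realType) (N : nat) (x0 : 'rV[R]_N).

(** [f] is jointly continuous at [(x0, 0)] and strictly differentiable in its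
    vector argument, with differential [l], uniformly in the real parameter
    near [0]. *)
Definition strictly_diff (f : 'rV[R]_N -> R -> R) (l : 'rV[R]_N -> R) : Prop :=
  [/\ scalar l,
      f z.1 z.2 @[z --> (x0, 0 : R)] --> f x0 0 &
      forall e : R, 0 < e ->
        \forall z \near ((x0, x0), 0 : R),
          `|f z.1.1 z.2 - f z.1.2 z.2 - l (z.1.1 - z.1.2)|
            <= e * `|z.1.1 - z.1.2|].

Lemma le_entry_norm (x : 'rV[R]_N) i : `|x 0 i| <= `|x|.
Proof.
rewrite [leRHS]/Num.Def.normr/= mx_normrE.
exact: (le_bigmax _ (fun ij : 'I_1 * 'I_N => `|x ij.1 ij.2|) (0, i)).
Qed.

Lemma norm_le_entry (x : 'rV[R]_N) (c : R) :
  0 <= c -> (forall i, `|x 0 i| <= c) -> `|x| <= c.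
Proof.
move=> c0 xc; rewrite [leLHS]/Num.Def.normr/= mx_normrE bigmax_le//= => -[i j] _.
by rewrite ord1; exact: xc.
Qed.

Lemma scalar_sum_delta (l : 'rV[R]_N -> R) (h : 'rV[R]_N) : scalar l ->
  l h = \sum_j h 0 j * l (delta_mx 0 j).
Proof.
move=> lin; have l0 : l 0 = 0.
  by have := lin (-1) 0 0; rewrite scaleN1r oppr0 addr0 mulN1r addNr.
rewrite {1}(row_sum_delta h).
elim/big_rec2: _ => [|j y z _ <-]; first exact: l0.
exact: lin.
Qed.

Lemma scalar_bounded (l : 'rV[R]_N -> R) : scalar l ->
  exists2 C : R, 0 < C & forall h, `|l h| <= C * `|h|.
Proof.
move=> lin; exists (1 + \sum_j `|l (delta_mx 0 j)|).
  by rewrite ltr_pwDl// sumr_ge0.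
move=> h; rewrite (scalar_sum_delta h lin) mulrDl mul1r.
apply: (@le_trans _ _ ((\sum_j `|l (delta_mx 0 j)|) * `|h|)); last by rewrite lerDr.
apply: le_trans (ler_norm_sum _ _ _) _.
rewrite mulr_suml ler_sum// => j _.
by rewrite normrM mulrC ler_wpM2l// le_entry_norm.
Qed.

Lemma strictly_diff_cst (g : R -> R) : g d @[d --> 0] --> g 0 ->
  strictly_diff (fun _ d => g d) (fun=> 0).
Proof.
move=> g0; split=> [a u v|/=|e e0]; first by rewrite mulr0 addr0.
  exact: (cvg_comp _ _ (@cvg_snd _ _ (nbhs x0) (nbhs (0:R)) _) g0).
by near=> z; rewrite subrr subr0 normr0 mulr_ge0// ltW.
Unshelve. all: by end_near.
Qed.

Lemma strictly_diff_coord (i : 'I_N) :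
  strictly_diff (fun x _ => x 0 i) (fun h => h 0 i).
Proof.
split=> [a u v|/=|e e0]; first by rewrite !mxE.
  apply: (@cvg_comp _ _ _ fst (fun x : 'rV[R]_N => x 0 i) _ (nbhs x0)).
    exact: (@cvg_fst _ _ (nbhs x0) (nbhs (0:R)) _).
  exact: coord_continuous.
by near=> z; rewrite !mxE subrr normr0 mulr_ge0// ltW.
Unshelve. all: by end_near.
Qed.

Lemma strictly_diffD f g lf lg : strictly_diff f lf -> strictly_diff g lg ->
  strictly_diff (fun x d => f x d + g x d) (fun h => lf h + lg h).
Proof.
move=> [linf f0 df] [ling g0 dg]; split=> [a u v|/=|e e0].
- by rewrite linf ling; ring.
- exact: cvgD.
- have e20 : 0 < e / 2 by rewrite divr_gt0.
  near=> z.
  have dfz : `|f z.1.1 z.2 - f z.1.2 z.2 - lf (z.1.1 - z.1.2)| <= e / 2 * `|z.1.1 - z.1.2|.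
    by near: z; exact: df.
  have dgz : `|g z.1.1 z.2 - g z.1.2 z.2 - lg (z.1.1 - z.1.2)| <= e / 2 * `|z.1.1 - z.1.2|.
    by near: z; exact: dg.
  rewrite [e]splitr mulrDl; apply: le_trans _ (lerD dfz dgz).
  apply: le_trans _ (ler_normD _ _).
  by rewrite le_eqVlt; apply/orP; left; apply/eqP; congr (`|_|); ring.
Unshelve. all: by end_near. Qed.

Lemma strictly_diffM f g lf lg : strictly_diff f lf -> strictly_diff g lg ->
  strictly_diff (fun x d => f x d * g x d)
                (fun h => f x0 0 * lg h + g x0 0 * lf h).
Proof.
move=> [linf f0 df] [ling g0 dg]; split=> [a u v|/=|e e0].
- by rewrite linf ling; ring.
- exact: cvgM.
have [Cf Cf0 lef] := scalar_bounded linf.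
have [Cg Cg0 leg] := scalar_bounded ling.
pose K := `|f x0 0| + 1 + (`|g x0 0| + 1) + Cf + Cg.
have K0 : 0 < K by rewrite /K; do 2 apply: addr_gt0 => //; apply: addr_gt0; rewrite ltr_wpDl.
pose e1 := e / (4 * K).
have e10 : 0 < e1 by rewrite divr_gt0// mulr_gt0.
have near_f : \forall z \near (x0, 0 : R),
    `|f z.1 z.2 - f x0 0| <= e1 /\ `|f z.1 z.2| <= K.
  have /cvgrPdist_le f0' := f0.
  apply: filterS2 (f0' _ e10) (f0' 1 ltr01) => z /= h1 h2; split.
    by rewrite distrC.
  rewrite -(subrK (f x0 0) (f z.1 z.2)); apply: le_trans (ler_normD _ _) _.
  rewrite distrC /K; have := normr_ge0 (g x0 0); lra.
have near_g : \forall z \near (x0, 0 : R),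
    `|g z.1 z.2 - g x0 0| <= e1 /\ `|g z.1 z.2| <= K.
  have /cvgrPdist_le g0' := g0.
  apply: filterS2 (g0' _ e10) (g0' 1 ltr01) => z /= h1 h2; split.
    by rewrite distrC.
  rewrite -(subrK (g x0 0) (g z.1 z.2)); apply: le_trans (ler_normD _ _) _.
  rewrite distrC /K; have := normr_ge0 (f x0 0); lra.
have to1 : (z.1.1, z.2) @[z --> ((x0, x0), 0 : R)] --> (x0, 0 : R).
  apply: (@cvg_pair _ _ _ _ (nbhs x0) (nbhs (0:R))) => /=.
    exact: (cvg_comp _ _ (@cvg_fst _ _ (nbhs (x0, x0)) (nbhs (0:R)) _)
                         (@cvg_fst _ _ (nbhs x0) (nbhs x0) _)).
  exact: (@cvg_snd _ _ (nbhs (x0, x0)) (nbhs (0:R)) _).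
have to2 : (z.1.2, z.2) @[z --> ((x0, x0), 0 : R)] --> (x0, 0 : R).
  apply: (@cvg_pair _ _ _ _ (nbhs x0) (nbhs (0:R))) => /=.
    exact: (cvg_comp _ _ (@cvg_fst _ _ (nbhs (x0, x0)) (nbhs (0:R)) _)
                         (@cvg_snd _ _ (nbhs x0) (nbhs x0) _)).
  exact: (@cvg_snd _ _ (nbhs (x0, x0)) (nbhs (0:R)) _).
near=> z.
have [f1 f2] : `|f z.1.1 z.2 - f x0 0| <= e1 /\ `|f z.1.1 z.2| <= K.
  by near: z; exact: to1 near_f.
have [g1 g2] : `|g z.1.2 z.2 - g x0 0| <= e1 /\ `|g z.1.2 z.2| <= K.
  by near: z; exact: to2 near_g.
have df1 : `|f z.1.1 z.2 - f z.1.2 z.2 - lf (z.1.1 - z.1.2)| <= e1 * `|z.1.1 - z.1.2|.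
  by near: z; exact: df.
have dg1 : `|g z.1.1 z.2 - g z.1.2 z.2 - lg (z.1.1 - z.1.2)| <= e1 * `|z.1.1 - z.1.2|.
  by near: z; exact: dg.
have {lef} lef := lef (z.1.1 - z.1.2); have {leg} leg := leg (z.1.1 - z.1.2).
set h := z.1.1 - z.1.2 in df1 dg1 lef leg *.
have -> : f z.1.1 z.2 * g z.1.1 z.2 - f z.1.2 z.2 * g z.1.2 z.2
    - (f x0 0 * lg h + g x0 0 * lf h) =
    f z.1.1 z.2 * (g z.1.1 z.2 - g z.1.2 z.2 - lg h)
    + g z.1.2 z.2 * (f z.1.1 z.2 - f z.1.2 z.2 - lf h)
    + (f z.1.1 z.2 - f x0 0) * lg h + (g z.1.2 z.2 - g x0 0) * lf h by ring.
have CfK : Cf <= K by rewrite /K; have := normr_ge0 (f x0 0); have := normr_ge0 (g x0 0); lra.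
have CgK : Cg <= K by rewrite /K; have := normr_ge0 (f x0 0); have := normr_ge0 (g x0 0); lra.
have prod_le (a b c d : R) : `|a| <= c -> `|b| <= d -> `|a * b| <= c * d.
  by move=> *; rewrite normrM ler_pM.
have b1 := prod_le _ _ _ _ f2 dg1.
have b2 := prod_le _ _ _ _ g2 df1.
have b3 := prod_le _ _ _ _ f1 (le_trans leg (ler_wpM2r (normr_ge0 h) CgK)).
have b4 := prod_le _ _ _ _ g1 (le_trans lef (ler_wpM2r (normr_ge0 h) CfK)).
(* the error splits into four terms, each at most K * e1 * `|h| *)
have eE : e * `|h| = 4 * (K * (e1 * `|h|)).
  by rewrite /e1; field; rewrite gt_eqF.
rewrite eE.
apply: le_trans (ler_normD _ _) _.
apply: le_trans (lerD (ler_normD _ _) (lexx _)) _.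
apply: le_trans (lerD (lerD (ler_normD _ _) (lexx _)) (lexx _)) _.
have -> : 4 * (K * (e1 * `|h|)) = K * (e1 * `|h|) + K * (e1 * `|h|)
  + e1 * (K * `|h|) + e1 * (K * `|h|) by ring.
by rewrite !lerD.
Unshelve. all: by end_near. Qed.

Lemma mulmx_bounded (A : 'M[R]_N) :
  exists2 C : R, 0 < C & forall h : 'rV[R]_N, `|h *m A| <= C * `|h|.
Proof.
have lin j : scalar (fun h : 'rV[R]_N => (h *m A) 0 j).
  by move=> a u v; rewrite mulmxDl -scalemxAl !mxE.
have ex_C : forall j : 'I_N, exists C : R,
    0 < C /\ forall h : 'rV[R]_N, `|(h *m A) 0 j| <= C * `|h|.
  by move=> j; have [C C0 leC] := scalar_bounded (lin j); exists C.
have [C HC] := choice ex_C.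
exists (1 + \sum_j C j).
  by rewrite ltr_pwDl// sumr_ge0// => j _; rewrite ltW//; have [] := HC j.
move=> h; apply: norm_le_entry => [|j].
  rewrite mulr_ge0// addr_ge0// sumr_ge0// => j _.
  by rewrite ltW//; have [] := HC j.
have [_ /(_ h)/le_trans->//] := HC j.
rewrite ler_wpM2r// (bigD1 j)//= addrCA lerDl addr_ge0// sumr_ge0// => k _.
by rewrite ltW//; have [] := HC k.
Qed.

(** A solution of [F x d = 0] is the fixed point of the Newton map
    [x - F x d *m A^-1], with [A] the Jacobian matrix at [(x0, 0)]; strict
    differentiability makes this map a contraction with ratio 1/2 near [x0]. *)
Theorem strict_implicit_function
    (F : 'I_N -> 'rV[R]_N -> R -> R) (l : 'I_N -> 'rV[R]_N -> R) :
  (forall i, strictly_diff (F i) (l i)) ->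
  (forall h, (forall i, l i h = 0) -> h = 0) ->
  (forall i, F i x0 0 = 0) ->
  exists x : R -> 'rV[R]_N,
    (\forall d \near 0, forall i, F i (x d) d = 0) /\ x d @[d --> 0] --> x0.
Proof.
move=> dF injl Fx0.
pose A : 'M[R]_N := \matrix_(j, i) l i (delta_mx 0 j).
have lA h i : (h *m A) 0 i = l i h.
  have [lin _ _] := dF i.
  by rewrite (scalar_sum_delta h lin) mxE; apply: eq_bigr => j _; rewrite mxE.
have uA : A \in unitmx.
  rewrite -row_free_unit; apply: inj_row_free => v vA0; apply: injl => i.
  by rewrite -lA vA0 mxE.
pose Fv x d : 'rV[R]_N := \row_i F i x d.
pose T d x := x - Fv x d *m invmx A.
have [C C0 leC] := mulmx_bounded (invmx A).
have e0 : 0 < (2 * C)^-1 by rewrite invr_gt0 mulr_gt0.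
have [r r0 Tlip] : exists2 r : R, 0 < r & forall x y d,
    `|x - x0| <= r -> `|y - x0| <= r -> `|d| <= r ->
    `|T d x - T d y| <= 2^-1 * `|x - y|.
  have : \forall z \near ((x0, x0), 0 : R), forall i,
      `|F i z.1.1 z.2 - F i z.1.2 z.2 - l i (z.1.1 - z.1.2)|
        <= (2 * C)^-1 * `|z.1.1 - z.1.2|.
    apply: (@filter_forall _ _ _ (nbhs ((x0, x0), 0 : R)) (nbhs_filter _)) => i.
    by have [_ _] := dF i; exact.
  move=> /nbhs_ballP[r /= r0 Hr]; exists (r / 2); first by rewrite divr_gt0.
  move=> x y d xr yr dr.
  have rr : r / 2 < r by rewrite ltr_pdivrMr// ltr_pMr// ltr1n.
  have Hxy : forall i, `|F i x d - F i y d - l i (x - y)| <= (2 * C)^-1 * `|x - y|.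
    apply: (Hr ((x, y), d)); split=> /=; first split.
    - by rewrite -ball_normE /= distrC (le_lt_trans xr).
    - by rewrite -ball_normE /= distrC (le_lt_trans yr).
    - by rewrite -ball_normE /= sub0r normrN (le_lt_trans dr).
  have -> : T d x - T d y = - ((Fv x d - Fv y d - (x - y) *m A) *m invmx A).
    rewrite /T mulmxBl mulmxK// mulmxBl !opprB.
    by rewrite addrACA [RHS]addrACA; congr (_ + _); exact: addrC.
  rewrite normrN; apply: le_trans (leC _) _.
  have -> : 2^-1 * `|x - y| = C * ((2 * C)^-1 * `|x - y|).
    by field; rewrite gt_eqF.
  rewrite ler_pM2l//; apply: norm_le_entry => [|i].
    by rewrite mulr_ge0// ltW.
  by have := Hxy i; rewrite -lA !mxE.
have Fv0 : Fv x0 d @[d --> 0] --> (0 : 'rV[R]_N).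
  apply/cvgrPdist_le => e e_gt0.
  have : \forall d \near (0:R), forall i, `|F i x0 d| <= e.
    apply: (@filter_forall _ _ _ (nbhs (0 : R)) (nbhs_filter _)) => i; have [_ Fi0 _] := dF i.
    have x0d : (x0, d) @[d --> (0:R)] --> (x0, 0 : R).
      apply: (@cvg_pair _ _ _ _ (nbhs x0) (nbhs (0 : R))) => /=.
        exact: cvg_cst.
      exact: cvg_id.
    have := cvg_comp _ _ x0d Fi0; rewrite Fx0 /= => /cvgrPdist_le/(_ _ e_gt0).
    by apply: filterS => d /=; rewrite sub0r normrN.
  apply: filterS => d Hd; apply: norm_le_entry => [|i]; first exact: ltW.
  by rewrite sub0r !mxE normrN.
have fixT d : `|d| <= r -> C * `|Fv x0 d| <= r / 2 ->
    exists p, (forall i, F i p d = 0) /\ `|p - x0| <= 2 * C * `|Fv x0 d|.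
  move=> dr Fr.
  pose U := [set x : 'rV[R]_N | `|x - x0| <= r].
  have Ux0 : U x0 by rewrite /U /= subrr normr0 ltW.
  have Tx0 : `|T d x0 - x0| <= C * `|Fv x0 d|.
    by rewrite /T addrC addKr normrN.
  have TU : set_fun U U (T d).
    move=> x Ux; rewrite /U /= -(subrK (T d x0) (T d x)) -addrA.
    apply: le_trans (ler_normD _ _) _; rewrite [r]splitr lerD//.
      apply: le_trans (Tlip _ _ _ Ux Ux0 dr) _.
      by rewrite mulrC ler_pM2r.
    exact: le_trans Tx0 Fr.
  pose f : {fun U >-> U} := HB.pack (T d) (isFun.Build _ _ U U (T d) TU).
  have fctr : is_contraction f.
    exists 2^-1%:nng; split; first by rewrite /= invf_lt1// ltr1n.
    by move=> [x y] [/= Ux Uy]; exact: Tlip.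
  have clU : closed U.
    rewrite (_ : U = closed_ball x0 r); first exact: closed_ball_closed.
    rewrite closed_ballE//; apply/seteqP; split=> x;
      by rewrite /U /closed_ball_ /= distrC.
  have [p Up pfix] := banach_fixed_point fctr clU (ex_intro _ _ Ux0).
  have {}pfix : p = T d p by [].
  exists p; split=> [i|].
    have : Fv p d *m invmx A = 0.
      by move/eqP: pfix; rewrite /T -subr_eq0 opprD opprK addNKr => /eqP.
    move/(congr1 (fun M => M *m A)); rewrite mulmxKV// mul0mx => /rowP/(_ i).
    by rewrite !mxE.
  have := Tlip _ _ _ Up Ux0 dr; rewrite -pfix => lip.
  have := ler_normD (p - T d x0) (T d x0 - x0); rewrite addrA subrK => tri.
  by lra.
have ex_p : forall d, exists p,
    `|d| <= r -> C * `|Fv x0 d| <= r / 2 ->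
    (forall i, F i p d = 0) /\ `|p - x0| <= 2 * C * `|Fv x0 d|.
  move=> d; have [dr|dr] := boolP (`|d| <= r); last by exists 0.
  have [Fr|Fr] := boolP (C * `|Fv x0 d| <= r / 2); last by exists 0.
  by have [p Hp] := fixT d dr Fr; exists p.
have [x Hx] := choice ex_p.
have nr : \forall d \near (0:R), `|d| <= r.
  exact: nbhs0_le.
have nF : \forall d \near (0:R), C * `|Fv x0 d| <= r / 2.
  have rC : 0 < r / 2 / C by rewrite !divr_gt0.
  have /cvgrPdist_le/(_ _ rC) := Fv0; apply: filterS => d.
  by rewrite sub0r normrN ler_pdivlMr// mulrC.
exists x; split.
  by near=> d; have [||] := Hx d; [near: d|near: d|].
apply/cvgrPdist_le => e e_gt0.
have eC : 0 < e / (2 * C) by rewrite divr_gt0// mulr_gt0.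
have /cvgrPdist_le/(_ _ eC) nE := Fv0.
near=> d; have [||_] := Hx d; [by near: d|by near: d|].
rewrite distrC => /le_trans; apply; rewrite mulrC -ler_pdivlMr ?mulr_gt0//.
by rewrite -normrN -sub0r; near: d.
Unshelve. all: by end_near. Qed.

End StrictDifferentiability.

(** Replaces a function and its differential by pointwise equal ones. *)
Lemma strictly_diff_ext (R : realType) (N : nat) (x0 : 'rV[R]_N) f g l l' :
  strictly_diff x0 f l -> (forall x d, f x d = g x d) -> (forall h, l h = l' h) ->
  strictly_diff x0 g l'.
Proof.
move=> dfl fg ll'; have -> : g = f by apply/funext => x; apply/funext.
by have -> : l' = l by apply/funext.
Qed.

Lemma strictly_diffZ (R : realType) (N : nat) (x0 : 'rV[R]_N) (a : R) f l :
  strictly_diff x0 f l ->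
  strictly_diff x0 (fun x d => a * f x d) (fun h => a * l h).
Proof.
move=> dfl; have dfa : strictly_diff x0 (fun _ _ => a) (fun=> 0).
  by apply: (strictly_diff_cst _ (g := fun=> a)); exact: cvg_cst.
by apply: strictly_diff_ext (strictly_diffM dfa dfl) _ _ => //= h; ring.
Qed.


(** * Steady states and the nonexistence of jumps *)

Section SteadyStates.
Variables (R : realType) (n : nat) (kappa eps : R) (u v : 'I_n -> R).
Hypotheses (kappa0 : 0 < kappa) (eps0 : 0 < eps).
Hypothesis uv_steady : steady_state kappa eps u v.

Lemma ex_argmin (f : 'I_n -> R) (k0 : 'I_n) : exists k, forall j, f k <= f j.
Proof.
case: (@arg_minP _ R 'I_n k0 xpredT f isT) => k _ kmin.
by exists k => j; exact: kmin.
Qed.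

Lemma ex_argmax (f : 'I_n -> R) (k0 : 'I_n) : exists k, forall j, f j <= f k.
Proof.
have [k kmin] := ex_argmin (fun j => - f j) k0.
by exists k => j; rewrite -lerN2.
Qed.

Lemma lap_argmin (f : 'I_n -> R) k : (forall j, f k <= f j) -> 0 <= lap f k.
Proof. by move=> kmin; rewrite /lap; have := kmin (ordS k); have := kmin (ord_pred k); lra. Qed.

Lemma lap_argmax (f : 'I_n -> R) k : (forall j, f j <= f k) -> lap f k <= 0.
Proof. by move=> kmax; rewrite /lap; have := kmax (ordS k); have := kmax (ord_pred k); lra. Qed.

Let d := eps ^+ 2.
Let d0 : 0 < d. Proof. exact: exprn_gt0. Qed.
Let kd0 : 0 < kappa * d. Proof. exact: mulr_gt0. Qed.

Lemma steady_v_gt0 k : 0 < v k.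
Proof.
have [j jmin] := ex_argmin v k.
have [_ _ ev] := uv_steady j; have [vk _ _] := uv_steady k.
rewrite lt_def vk; apply: le_trans (jmin k).
have := mulr_ge0 (ltW kd0) (lap_argmin jmin); have := sqr_ge0 (u j).
by rewrite /d in ev *; lra.
Qed.

Lemma steady_u_ge0 k : 0 <= u k.
Proof.
have [j jmin] := ex_argmin u k.
have [_ eu _] := uv_steady j; apply: le_trans (jmin k).
have := mulr_ge0 (ltW d0) (lap_argmin jmin).
have := divr_ge0 (sqr_ge0 (u j)) (ltW (steady_v_gt0 j)).
by rewrite /d in eu *; lra.
Qed.

Lemma steady_sqr_u_le k : u k ^+ 2 <= (1 + 2 * (kappa * d)) * v k.
Proof.
have [_ _ ev] := uv_steady k; rewrite /lap -/d in ev.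
have := mulr_ge0 (ltW kd0) (addr_ge0 (ltW (steady_v_gt0 (ordS k)))
                                     (ltW (steady_v_gt0 (ord_pred k)))).
by lra.
Qed.

Lemma steady_u_le k : u k <= 1 + 2 * (kappa * d).
Proof.
have [j jmax] := ex_argmax u k; apply: le_trans (jmax k) _.
have := steady_u_ge0 j; rewrite le_eqVlt => /predU1P[<-|uj0].
  by have := kd0; lra.
have vu : v j <= u j.
  have [_ eu _] := uv_steady j.
  have : u j <= u j ^+ 2 / v j.
    have := mulr_le0_ge0 (lap_argmax jmax) (ltW d0); rewrite mulrC.
    by rewrite /d in eu *; lra.
  by rewrite ler_pdivlMr ?steady_v_gt0// expr2 ler_pM2l.
have K0 : 0 <= 1 + 2 * (kappa * d) by have := kd0; lra.
have := le_trans (steady_sqr_u_le j) (ler_wpM2l K0 vu).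
by rewrite expr2 ler_pM2r.
Qed.

Lemma steady_v_le k : v k <= (1 + 2 * (kappa * d)) ^+ 2.
Proof.
have [j jmax] := ex_argmax v k; apply: le_trans (jmax k) _.
have [_ _ ev] := uv_steady j.
apply: (@le_trans _ _ (u j ^+ 2)).
  have := mulr_le0_ge0 (lap_argmax jmax) (ltW kd0); rewrite mulrC.
  by rewrite /d in ev *; lra.
by rewrite lerXn2r ?nnegrE ?steady_u_ge0 ?steady_u_le// ltW// ltr_wpDr// ltW// mulr_gt0.
Qed.

(** The equation for [u k] is quadratic with the real root [u k], so its
    discriminant is nonnegative. *)
Lemma steady_discriminant k :
  4 * d * (u (ordS k) + u (ord_pred k)) <= (1 + 2 * d) ^+ 2 * v k.
Proof.
have [_ eu _] := uv_steady k; rewrite /lap -/d in eu.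
have v0 := steady_v_gt0 k.
have ds : d * (u (ordS k) + u (ord_pred k)) = (1 + 2 * d) * u k - u k ^+ 2 / v k.
  by lra.
rewrite -mulrA ds -subr_ge0.
have -> : (1 + 2 * d) ^+ 2 * v k - 4 * ((1 + 2 * d) * u k - u k ^+ 2 / v k) =
    (2 * u k - (1 + 2 * d) * v k) ^+ 2 / v k by field; rewrite gt_eqF.
by rewrite divr_ge0 ?sqr_ge0// ltW.
Qed.

Lemma steady_u_le_v k : u k <= (1 + 2 * d) * v k.
Proof.
have [_ eu _] := uv_steady k; rewrite /lap -/d in eu.
have v0 := steady_v_gt0 k.
have := mulr_ge0 (ltW d0) (addr_ge0 (steady_u_ge0 (ordS k)) (steady_u_ge0 (ord_pred k))).
have [->|u0] := eqVneq (u k) 0; first by move=> _; rewrite mulr_ge0 ?addr_ge0 ?mulr_ge0// ltW.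
move=> s0; have : u k ^+ 2 / v k <= (1 + 2 * d) * u k by lra.
rewrite ler_pdivrMr// expr2 mulrAC ler_pM2r//.
by rewrite lt_def u0 steady_u_ge0.
Qed.

Lemma steady_v_le_u k :
  v k <= u k + 4 * (kappa * d) * (1 + 2 * (kappa * d)) ^+ 2.
Proof.
have [_ _ ev] := uv_steady k; rewrite /lap -/d in ev.
set a := kappa * d in ev *; have a0 : 0 < a := kd0.
have u0 := steady_u_ge0 k; have u1 := steady_u_le k; rewrite -/a in u1.
have uu : u k ^+ 2 <= u k * (1 + 2 * a) by rewrite expr2 ler_wpM2l.
have v1 := ler_wpM2l (ltW a0) (steady_v_le (ordS k)).
have v2 := ler_wpM2l (ltW a0) (steady_v_le (ord_pred k)).
have v3 := mulr_ge0 (ltW a0) (ltW (steady_v_gt0 k)).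
rewrite -/a in v1 v2.
have au := ler_wpM2l (ltW a0) u1.
have a2 : 0 <= a * (2 * a) by rewrite !mulr_ge0// ltW.
have a3 : 0 <= a * (2 * a) * a by rewrite !mulr_ge0// ltW.
by rewrite -/a in ev; lra.
Qed.

(** The obstruction to a jump from [k] to its successor [p]: along a family
    with a jump, [c] tends to [4 - kappa] and the right-hand side to [0]. *)
Lemma steady_jump_bound k :
  let p := ordS k in
  let c := 4 * (1 + 2 * (kappa * d) - (1 + 2 * d) ^+ 2 * v p)
           - (1 + 2 * d) ^+ 2 * kappa in
  0 <= c ->
  u k * c <= (1 + 2 * d) ^+ 2 * kappa *
    (v k - u k + 4 * (kappa * d) * (1 + 2 * (kappa * d)) ^+ 2).
Proof.
move=> p c c0.
have disc := steady_discriminant p; have uv := steady_u_le_v p.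
rewrite /p ordSK -/p in disc.
have [_ _ ev] := uv_steady p; rewrite /lap {2}/p ordSK -/d in ev.
set q := ordS p in disc ev.
have vq := steady_v_le_u q.
set e := 4 * (kappa * d) * (1 + 2 * (kappa * d)) ^+ 2 in vq *.
have v0 := steady_v_gt0 p.
have d1 : 0 < 1 + 2 * d by rewrite addr_gt0// mulr_gt0.
have uu : u p ^+ 2 <= (1 + 2 * d) ^+ 2 * v p * v p.
  by rewrite -mulrA -expr2 -exprMn lerXn2r ?nnegrE ?steady_u_ge0// mulr_ge0// ltW.
have [c1|c1] := leP (1 + 2 * (kappa * d) - (1 + 2 * d) ^+ 2 * v p) 0.
  (* in this case c < 0, against c0 *)
  have : 0 < (1 + 2 * d) ^+ 2 * kappa by rewrite mulr_gt0// exprn_gt0.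
  by rewrite /c in c0; lra.
have [w wE] : exists w, w = 1 + 2 * (kappa * d) - (1 + 2 * d) ^+ 2 * v p by eexists.
rewrite /c -wE in c0 c1 *.
have vw : v p * w <= kappa * d * (v q + v k) by rewrite wE; lra.
have key : 4 * (u q + u k) * w <= (1 + 2 * d) ^+ 2 * kappa * (v q + v k).
  rewrite -(ler_pM2l d0).
  have := ler_wpM2r (ltW c1) disc.
  have := ler_wpM2l (sqr_ge0 (1 + 2 * d)) vw.
  by lra.
have D0 : 0 < (1 + 2 * d) ^+ 2 * kappa by rewrite mulr_gt0// exprn_gt0.
have := ler_wpM2l (ltW D0) vq.
have := mulr_ge0 (steady_u_ge0 q) c0.
set D := (1 + 2 * d) ^+ 2 * kappa in key c0 *.
by lra.
Qed.

End SteadyStates.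

Lemma no_jump_solution (R : realType) (n : nat) (kappa : R) (k : 'I_n) :
  0 < kappa -> kappa < 4 -> ~ jump_solution kappa k.
Proof.
move=> kappa0 kappa4 [eps [U [V [[eps_gt0 eps_to0] st [Uk Vk] [Up Vp]]]]].
pose d j := eps j ^+ 2.
have d0 : d j @[j --> \oo] --> (0 : R).
  by have := cvgM eps_to0 eps_to0; rewrite mulr0; exact.
pose c j := 4 * (1 + 2 * (kappa * d j) - (1 + 2 * d j) ^+ 2 * V j (ordS k))
           - (1 + 2 * d j) ^+ 2 * kappa.
have d1 : (1 + 2 * d j) ^+ 2 @[j --> \oo] --> (1 : R).
  have h : 1 + 2 * d j @[j --> \oo] --> (1 + 2 * 0 : R).
    by apply: cvgD; [exact: cvg_cst|apply: cvgM => //; exact: cvg_cst].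
  have := cvgM h h; rewrite mulr0 addr0 mulr1.
  exact.
have kd : 1 + 2 * (kappa * d j) @[j --> \oo] --> (1 : R).
  have h : 1 + 2 * (kappa * d j) @[j --> \oo] --> (1 + 2 * (kappa * 0) : R).
    apply: cvgD; first exact: cvg_cst.
    by do 2 (apply: cvgM; first exact: cvg_cst).
  by rewrite !mulr0 addr0 in h.
have c_lim : c j @[j --> \oo] --> 4 - kappa.
  have -> : 4 - kappa = 4 * (1 - 1 * 0) - 1 * kappa by ring.
  apply: cvgB; last by apply: cvgM => //; exact: cvg_cst.
  apply: cvgM; first exact: cvg_cst.
  by apply: cvgB => //; apply: cvgM.
have k40 : 0 < 4 - kappa by rewrite subr_gt0.
have lhs : U j k * c j @[j --> \oo] --> 4 - kappa.
  by rewrite -[4 - kappa]mul1r; exact: cvgM.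
have rhs : (1 + 2 * d j) ^+ 2 * kappa *
    (V j k - U j k + 4 * (kappa * d j) * (1 + 2 * (kappa * d j)) ^+ 2)
    @[j --> \oo] --> (0 : R).
  have -> : 0 = 1 * kappa * (1 - 1 + 4 * (kappa * 0) * (1 * 1)) :> R by ring.
  apply: cvgM; first by apply: cvgM => //; exact: cvg_cst.
  apply: cvgD; first exact: cvgB.
  apply: cvgM; last exact: (cvgM kd kd).
  by do 2 (apply: cvgM; first exact: cvg_cst).
suff : 4 - kappa <= 0 by rewrite leNgt k40.
apply: (ler_cvg_to lhs rhs).
have /cvgrPdist_lt/(_ _ k40) := c_lim; apply: filterS => j cj.
apply: (steady_jump_bound kappa0 (eps_gt0 j) (st j)).
by move: cj; rewrite ltr_norml -/(c j) => /andP[_]; lra.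
Qed.

(** * Localization of the eigenvalues *)

Section LinearStability.
Variables (R : realType) (n : nat) (kappa eps : R) (u v : 'I_n -> R).
Hypotheses (kappa0 : 0 < kappa) (eps0 : 0 < eps).
Local Open Scope complex_scope.

Local Notation N := (@Normc.normc R).

Lemma normcR (r : R) : N r%:C = `|r|.
Proof. by rewrite /= expr0n/= addr0 sqrtr_sqr. Qed.

Lemma normcB_le (x y : R[i]) : N (x - y) <= N x + N y.
Proof. by apply: le_trans (le_normcD _ _) _; rewrite normcN. Qed.

Lemma Re_le_normc (z : R[i]) : complex.Re z <= N z.
Proof.
case: z => a b /=; apply: le_trans (ler_norm a) _.
by rewrite -sqrtr_sqr ler_wsqrtr// lerDl sqr_ge0.
Qed.

Lemma normc_ge0 (z : R[i]) : 0 <= N z.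
Proof. by case: z => a b; exact: sqrtr_ge0. Qed.

Lemma normc_lap_le (f : 'I_n -> R[i]) (k j : 'I_n) :
  (forall i, N (f i) <= N (f j)) -> N (lap f k) <= 4 * N (f j).
Proof.
move=> fj; rewrite /lap; apply: le_trans (normcB_le _ _) _.
have -> : N (2 * f k) = 2 * N (f k).
  by rewrite Normc.normcM -[2 in LHS](rmorph_nat (real_complex R)) normcR normr_nat.
have := le_normcD (f (ordS k)) (f (ord_pred k)).
have := fj k; have := fj (ordS k); have := fj (ord_pred k).
move=> h1 h2 h3 h4.
by lra.
Qed.

(** At some node [k], namely where the eigenfunction [phi] is largest, the real
    part of the eigenvalue exceeds the eigenvalue of the uncoupled node,
    [-1 + 2 w - 2 w ^+ 2 u] with [w = u k / v k], by at most [O(eps ^+ 2)]. *)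
Lemma lin_eigenvalue_bound (M : R) (lambda : R[i]) :
  (forall k, `|u k| <= M) -> (forall k, `|u k / v k| <= M) ->
  lin_eigenvalue kappa eps u v lambda ->
  exists k, complex.Re lambda <=
    -1 + 2 * (u k / v k) - 2 * (u k / v k) ^+ 2 * u k
    + eps ^+ 2 * (4 + 8 * M ^+ 3 * kappa).
Proof.
move=> uM wM [phi [psi [[k0 nz] eig]]].
have [k kmax] := ex_argmax (fun j => N (phi j)) k0; rewrite /= in kmax.
have [l lmax] := ex_argmax (fun j => N (psi j)) k0; rewrite /= in lmax.
exists k; set d := eps ^+ 2 in eig *.
have d0 : 0 < d by exact: exprn_gt0.
have M0 : 0 <= M by apply: le_trans (uM k0).
have kd0 : 0 < kappa * d by exact: mulr_gt0.
have psi_le : N (psi l) <= 2 * M * N (phi k).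
  have [_ ev] := eig l.
  have e1 : (1 + 2 * (kappa * d))%:C * psi l =
      (kappa * d)%:C * (psi (ordS l) + psi (ord_pred l)) + (2 * u l)%:C * phi l.
    rewrite /lap in ev; rewrite rmorphD rmorph1 rmorphM rmorph_nat.
    by rewrite -[LHS]addr0 [in LHS]ev; ring.
  have := congr1 N e1; rewrite Normc.normcM normcR ger0_norm; last by lra.
  move=> e2.
  have := le_normcD ((kappa * d)%:C * (psi (ordS l) + psi (ord_pred l)))
    ((2 * u l)%:C * phi l).
  rewrite -e2 !Normc.normcM !normcR (gtr0_norm kd0) normrM normr_nat.
  have h1 := le_normcD (psi (ordS l)) (psi (ord_pred l)).
  have h2 := lmax (ordS l); have h3 := lmax (ord_pred l); 
  have h4 : N (psi (ordS l) + psi (ord_pred l)) <= 2 * N (psi l).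
    by lra.
  have h5 := ler_wpM2l (ltW kd0) h4.
  have h6 : `|u l| * N (phi l) <= M * N (phi k).
    by apply: ler_pM => //; exact: normc_ge0.
  by lra.
have phi_gt0 : 0 < N (phi k).
  rewrite lt_def normc_ge0 andbT; apply/eqP => Nphi0.
  have phi0 j : phi j = 0.
    apply: Normc.eq0_normc; apply/eqP; rewrite eq_le (le_trans (kmax j)) ?Nphi0//=.
    exact: normc_ge0.
  have psi0 j : psi j = 0.
    apply: Normc.eq0_normc; apply/eqP; rewrite eq_le normc_ge0 andbT.
    by apply: le_trans (lmax j) _; rewrite (le_trans psi_le)// Nphi0 mulr0.
  by case: nz; rewrite ?phi0 ?psi0 eqxx.
set w := u k / v k.
pose mu : R := -1 + 2 * w - 2 * w ^+ 2 * u k.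
have [eu ev] := eig k.
have eqn : (lambda - mu%:C) * phi k =
    d%:C * lap phi k - (w ^+ 2 * (kappa * d))%:C * lap psi k.
  have uv2 : u k ^+ 2 / v k ^+ 2 = w ^+ 2 by rewrite /w expr_div_n.
  have uv1 : 2 * u k / v k = 2 * w by rewrite /w mulrA.
  rewrite uv1 uv2 in eu.
  have ev' : (kappa * d)%:C * lap psi k = psi k - (2 * u k)%:C * phi k.
    by apply/eqP; rewrite -subr_eq0; apply/eqP; rewrite [RHS]ev; ring.
  rewrite mulrBl eu [(w ^+ 2 * (kappa * d))%:C]rmorphM -mulrA ev' /mu.
  by rewrite !(rmorphD, rmorphB, rmorphN, rmorphM, rmorphXn, rmorph1, rmorph_nat); ring.
have := congr1 N eqn; rewrite Normc.normcM => Neqn.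
have := normcB_le (d%:C * lap phi k) ((w ^+ 2 * (kappa * d))%:C * lap psi k).
rewrite -Neqn; rewrite !Normc.normcM !normcR (gtr0_norm d0).
rewrite ger0_norm; last by rewrite mulr_ge0 ?sqr_ge0// ltW.
have l1 := normc_lap_le k kmax; have l2 := normc_lap_le k lmax.
have w2 : w ^+ 2 <= M ^+ 2.
  by rewrite -(real_normK (num_real w)) lerXn2r ?nnegrE//; exact: wM.
have b1 := ler_wpM2l (ltW d0) l1.
have b2 : w ^+ 2 * (kappa * d) * N (lap psi k) <=
    M ^+ 2 * (kappa * d) * (4 * (2 * M * N (phi k))).
  apply: ler_pM.
  - by rewrite mulr_ge0 ?sqr_ge0// ltW.
  - exact: normc_ge0.
  - by rewrite ler_pM2r.
  - by apply: le_trans l2 _; rewrite ler_pM2l.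
move=> b3.
have : N (lambda - mu%:C) * N (phi k) <= d * (4 + 8 * M ^+ 3 * kappa) * N (phi k).
  apply: (le_trans b3); apply: (le_trans (lerD b1 b2)).
  by rewrite le_eqVlt; apply/orP; left; apply/eqP; ring.
rewrite ler_pM2r// => /(le_trans (Re_le_normc _)).
rewrite raddfB /= /mu; lra.
Qed.

End LinearStability.

(** * Distance to the mesa *)

Section MesaDistance.
Variables (n m : nat).
Hypotheses (hm : (1 <= m)%N) (hmn : (m < n)%N).

(** The number of steps on the cycle from [k] to the nearest node of the mesa.
    The ordinal [k] is the node numbered [k.+1], and truncated subtraction gives
    [0] exactly on the mesa. *)
Definition mesa_dist (k : 'I_n) : nat := minn (k.+1 - m) (n - k).

Lemma val_ordS (k : 'I_n) : ordS k = (if k.+1 == n then 0 else k.+1) :> nat.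
Proof.
rewrite /=; case: eqP => [->|/eqP kn]; first by rewrite modnn.
by rewrite modn_small// ltn_neqAle kn ltn_ord.
Qed.

Lemma val_ord_pred (k : 'I_n) :
  ord_pred k = (if k == 0 :> nat then n.-1 else k.-1) :> nat.
Proof.
have := ltn_ord k; rewrite /=; case: eqP => [->|/eqP k0] kn.
  by rewrite add0n modn_small// prednK// (leq_ltn_trans _ kn).
have -> : (k + n).-1 = (k.-1 + n)%N by lia.
by rewrite modnDr modn_small//; lia.
Qed.

Lemma mesa_dist_eq0 (k : 'I_n) : (mesa_dist k == 0)%N = (k < m)%N.
Proof. by rewrite /mesa_dist; have := ltn_ord k; lia. Qed.

Lemma mesa_dist_ordS (k : 'I_n) : (mesa_dist k <= (mesa_dist (ordS k)).+1)%N.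
Proof. by rewrite /mesa_dist val_ordS; have := ltn_ord k; case: (k.+1 =P n); lia. Qed.

Lemma mesa_dist_ord_pred (k : 'I_n) : (mesa_dist k <= (mesa_dist (ord_pred k)).+1)%N.
Proof. by rewrite /mesa_dist val_ord_pred; have := ltn_ord k; case: ((k : nat) =P 0); lia. Qed.

(** The number of shortest paths from the mesa to [k]: two for the node at
    equal distance from both ends, if there is one, and one otherwise. *)
Definition mesa_paths (k : 'I_n) : nat := if (k.+1 - m == n - k)%N then 2 else 1.

Lemma mesa_paths_mesa (k : 'I_n) : (k < m)%N -> mesa_paths k = 1%N.
Proof. by rewrite /mesa_paths; have := ltn_ord k; case: eqP; lia. Qed.

(** The exponent [(mesa_dist j).+1 - mesa_dist k] vanishes exactly when the
    neighbour [j] of [k] is one step closer to the mesa. *)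
Lemma mesa_closer_ordS (k : 'I_n) :
  ((mesa_dist (ordS k)).+1 - mesa_dist k == 0)%N = (m <= k)%N && (n - k <= k.+1 - m)%N.
Proof. by rewrite /mesa_dist val_ordS; have := ltn_ord k; case: (k.+1 =P n); lia. Qed.

Lemma mesa_closer_ord_pred (k : 'I_n) :
  ((mesa_dist (ord_pred k)).+1 - mesa_dist k == 0)%N = (m <= k)%N && (k.+1 - m <= n - k)%N.
Proof. by rewrite /mesa_dist val_ord_pred; have := ltn_ord k; case: ((k : nat) =P 0); lia. Qed.

Lemma mesa_layer_ordS (k : 'I_n) : (m <= k)%N -> (n - k <= k.+1 - m)%N ->
  mesa_dist (ordS k) = (mesa_dist k).-1 /\ mesa_paths (ordS k) = 1%N.
Proof.
rewrite /mesa_dist /mesa_paths val_ordS; have := ltn_ord k.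
by case: (k.+1 =P n); (split; [|case: eqP]); lia.
Qed.

Lemma mesa_layer_ord_pred (k : 'I_n) : (m <= k)%N -> (k.+1 - m <= n - k)%N ->
  mesa_dist (ord_pred k) = (mesa_dist k).-1 /\ mesa_paths (ord_pred k) = 1%N.
Proof.
rewrite /mesa_dist /mesa_paths val_ord_pred; have := ltn_ord k.
by case: ((k : nat) =P 0); (split; [|case: eqP]); lia.
Qed.

Lemma mesa_dist_near (k : 'I_n) : (m <= k)%N -> (k.+1 < uphalf (n - m))%N ->
  mesa_dist k = (k.+1 - m)%N /\ mesa_paths k = 1%N.
Proof.
rewrite /mesa_dist /mesa_paths; have := ltn_ord k.
by split; [|case: eqP]; lia.
Qed.

Section Rescaled.
Variable R : realType.

(** [d] times the Laplacian, in the unknowns divided by [d ^+ mesa_dist]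
    ([rescaled_lapE]): a neighbour one step closer to the mesa enters with
    weight [1], one at the same distance with weight [d], one further away with
    weight [d ^+ 2]. *)
Definition rescaled_lap (d : R) (X : 'I_n -> R) (k : 'I_n) : R :=
  d ^+ ((mesa_dist (ordS k)).+1 - mesa_dist k) * X (ordS k)
  + d ^+ ((mesa_dist (ord_pred k)).+1 - mesa_dist k) * X (ord_pred k)
  - 2 * d * X k.

Lemma rescaled_lapE d X k :
  d * lap (fun j => d ^+ mesa_dist j * X j) k = d ^+ mesa_dist k * rescaled_lap d X k.
Proof.
have wt j : (mesa_dist k <= (mesa_dist j).+1)%N ->
    d * (d ^+ mesa_dist j * X j) =
    d ^+ mesa_dist k * (d ^+ ((mesa_dist j).+1 - mesa_dist k) * X j).
  by move=> kj; rewrite !mulrA -exprS -exprD subnKC.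
rewrite /lap mulrBr mulrDr !wt ?mesa_dist_ordS ?mesa_dist_ord_pred//.
by rewrite /rescaled_lap; ring.
Qed.

Lemma rescaled_lap0_eq0 X k :
  (forall j, (mesa_dist j < mesa_dist k)%N -> X j = 0) -> rescaled_lap 0 X k = 0.
Proof.
move=> X0; have term j : 0 ^+ ((mesa_dist j).+1 - mesa_dist k) * X j = 0.
  rewrite expr0n subn_eq0; case: ltnP => [/X0->|_]; first by rewrite mulr0.
  by rewrite mul0r.
by rewrite /rescaled_lap !term mulr0 mul0r addr0 subr0.
Qed.

(** At [d = 0], a function that depends only on the layer, weighted by the
    number of shortest paths, is carried from one layer to the next. *)
Lemma rescaled_lap0_layers (g : nat -> R) k :
  rescaled_lap 0 (fun j => g (mesa_dist j) * (mesa_paths j)%:R) k =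
  if (m <= k)%N then g (mesa_dist k).-1 * (mesa_paths k)%:R else 0.
Proof.
rewrite /rescaled_lap !expr0n mesa_closer_ordS mesa_closer_ord_pred.
rewrite mulr0 mul0r subr0.
case: leqP => km /=; last by rewrite !mul0r addr0.
have [le1|lt1] := leqP (n - k) (k.+1 - m).
  have [-> ->] := mesa_layer_ordS km le1.
  have [le2|lt2] := leqP (k.+1 - m) (n - k).
    have [-> ->] := mesa_layer_ord_pred km le2.
    have -> : mesa_paths k = 2%N by rewrite /mesa_paths eqn_leq le1 le2.
    by rewrite /=; ring.
  have -> : mesa_paths k = 1%N by rewrite /mesa_paths eqn_leq [(_ <= n - k)%N]leqNgt lt2.
  by rewrite /=; ring.
have [-> ->] := mesa_layer_ord_pred km (ltnW lt1).
have -> : mesa_paths k = 1%N by rewrite /mesa_paths eqn_leq [(n - k <= _)%N]leqNgt lt1 andbF.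
by rewrite ltnW//=; ring.
Qed.

End Rescaled.
End MesaDistance.

(** * The coefficients [eta_coef] *)

Section EtaCoef.
Variables (R : realType) (kappa : R).
Hypothesis kappa4 : 4 < kappa.

Lemma eta_coefS j : eta_coef kappa j.+1 =
  (1 - Num.sqrt (1 - 4 * eta_coef kappa j / kappa)) / 2.
Proof. by []. Qed.

Lemma eta_coef_bounds j : 0 < eta_coef kappa j <= 1.
Proof.
have k0 : 0 < kappa by apply: lt_trans kappa4.
elim: j => [|j /andP[e0 e1]]; first by rewrite /= ltr01 lexx.
rewrite eta_coefS; set s := Num.sqrt _; have s0 : 0 <= s by exact: sqrtr_ge0.
have : s < 1.
  by rewrite -sqrtr1 ltr_sqrt// ltrBlDr ltrDl divr_gt0// mulr_gt0.
by move=> s1; apply/andP; split; lra.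
Qed.

Lemma eta_coefS_lt_half j : eta_coef kappa j.+1 < 2^-1.
Proof.
have k0 : 0 < kappa by apply: lt_trans kappa4.
have /andP[e0 e1] := eta_coef_bounds j.
rewrite eta_coefS; set s := Num.sqrt _; suff : 0 < s by lra.
rewrite sqrtr_gt0 subr_gt0 ltr_pdivrMr// mul1r.
by apply: le_lt_trans kappa4; rewrite ler_piMr.
Qed.

Lemma eta_coefS_root j :
  eta_coef kappa j.+1 ^+ 2 - eta_coef kappa j.+1 + eta_coef kappa j / kappa = 0.
Proof.
have k0 : 0 < kappa by apply: lt_trans kappa4.
have /andP[e0 e1] := eta_coef_bounds j.
rewrite eta_coefS; set s := Num.sqrt _.
have : s ^+ 2 = 1 - 4 * eta_coef kappa j / kappa.
  rewrite sqr_sqrtr// subr_ge0 ler_pdivrMr// mul1r.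
  by apply: le_trans (ltW kappa4); rewrite ler_piMr.
by lra.
Qed.

End EtaCoef.

(** * The rescaled system and its branch of solutions *)

Section MesaBranch.
Variables (R : realType) (n m : nat) (kappa : R).
Hypotheses (hm : (1 <= m)%N) (hmn : (m < n)%N) (kappa4 : 4 < kappa).

Let dist := @mesa_dist n m.
Let kappa0 : 0 < kappa. Proof. exact: lt_trans kappa4. Qed.

(** The leading-order profile, in rescaled unknowns. *)
Definition mesa_v0 (k : 'I_n) : R := kappa ^+ dist k * (mesa_paths m k)%:R.
Definition mesa_u0 (k : 'I_n) : R :=
  eta_coef kappa (dist k) * kappa ^+ dist k * (mesa_paths m k)%:R.

Lemma mesa_v0_gt0 (k : 'I_n) : 0 < mesa_v0 k.
Proof. by rewrite /mesa_v0 mulr_gt0 ?exprn_gt0// /mesa_paths; case: ifP; rewrite ltr0n. Qed.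

Lemma mesa_u0E (k : 'I_n) : mesa_u0 k = eta_coef kappa (dist k) * mesa_v0 k.
Proof. by rewrite /mesa_u0 -mulrA. Qed.

Lemma mesa_dist_mesa (k : 'I_n) : (k < m)%N -> dist k = 0%N.
Proof. by rewrite -(mesa_dist_eq0 hm hmn) => /eqP. Qed.

Lemma mesa_v0_mesa (k : 'I_n) : (k < m)%N -> mesa_v0 k = 1.
Proof. by move=> km; rewrite /mesa_v0 mesa_dist_mesa// mesa_paths_mesa// mul1r. Qed.

Lemma mesa_u0_mesa (k : 'I_n) : (k < m)%N -> mesa_u0 k = 1.
Proof. by move=> km; rewrite mesa_u0E mesa_v0_mesa// mesa_dist_mesa// mul1r. Qed.

Lemma mesa_distS (k : 'I_n) : (m <= k)%N -> exists j, dist k = j.+1.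
Proof.
move=> mk; exists (dist k).-1; rewrite prednK// lt0n.
by rewrite (mesa_dist_eq0 hm hmn) -leqNgt.
Qed.

Lemma rescaled_lap_v0 (k : 'I_n) :
  rescaled_lap m 0 mesa_v0 k = if (m <= k)%N then mesa_v0 k / kappa else 0.
Proof.
rewrite /mesa_v0 (rescaled_lap0_layers hm hmn (fun j => kappa ^+ j)).
case: ifP => // mk; have [j jE] := mesa_distS mk; rewrite -/dist jE /= exprS.
by field; rewrite gt_eqF.
Qed.

Lemma rescaled_lap_u0 (k : 'I_n) :
  rescaled_lap m 0 mesa_u0 k =
  if (m <= k)%N then eta_coef kappa (dist k).-1 / kappa * mesa_v0 k else 0.
Proof.
rewrite /mesa_u0 (rescaled_lap0_layers hm hmn (fun j => eta_coef kappa j * kappa ^+ j)).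
case: ifP => // mk; rewrite /mesa_v0; have [j jE] := mesa_distS mk; rewrite -/dist jE /= exprS.
by field; rewrite gt_eqF.
Qed.

(** The rescaled equations at a node: with [d = eps ^+ 2], they are the two
    steady-state equations, the first multiplied by [v], divided by powers of
    [d]. They are polynomial in the unknowns and in [d], down to [d = 0]. *)
Definition rescaled_eq_u (d : R) (X Y : 'I_n -> R) (k : 'I_n) : R :=
  rescaled_lap m d X k * Y k + (-1 * (X k * Y k) + X k * X k).
Definition rescaled_eq_v (d : R) (X Y : 'I_n -> R) (k : 'I_n) : R :=
  kappa * rescaled_lap m d Y k + (-1 * Y k + d ^+ dist k * (X k * X k)).

Lemma rescaled_steady (eps : R) (X Y : 'I_n -> R) : 0 < eps ->
  (forall k, 0 < Y k) ->
  (forall k, rescaled_eq_u (eps ^+ 2) X Y k = 0) ->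
  (forall k, rescaled_eq_v (eps ^+ 2) X Y k = 0) ->
  steady_state kappa eps (fun k => (eps ^+ 2) ^+ dist k * X k)
                         (fun k => (eps ^+ 2) ^+ dist k * Y k).
Proof.
move=> eps0 Y0 eu ev k.
have d0 : 0 < eps ^+ 2 by exact: exprn_gt0.
set d := eps ^+ 2 in eu ev d0 *.
have D0 : 0 < d ^+ dist k by exact: exprn_gt0.
split.
- by rewrite gt_eqF// mulr_gt0.
- rewrite (rescaled_lapE hm hmn).
  have Yk : Y k != 0 by rewrite gt_eqF.
  have Dk : d ^+ dist k != 0 by rewrite gt_eqF.
  have -> : rescaled_lap m d X k = X k - X k ^+ 2 / Y k.
    apply: (mulIf Yk); rewrite [RHS]mulrBl divfK//.
    by have := eu k; rewrite /rescaled_eq_u; lra.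
  by rewrite -/dist; field; apply/andP.
- rewrite -mulrA (rescaled_lapE hm hmn) -/dist.
  have := ev k; rewrite /rescaled_eq_v => {}ev.
  have -> : rescaled_lap m d Y k = (Y k - d ^+ dist k * (X k * X k)) / kappa.
    apply: (mulfI (lt0r_neq0 kappa0)); rewrite mulrC mulrCA divff ?gt_eqF//.
    by lra.
  by field; rewrite gt_eqF.
Qed.

Lemma rescaled_eq_u0 (k : 'I_n) : rescaled_eq_u 0 mesa_u0 mesa_v0 k = 0.
Proof.
rewrite /rescaled_eq_u rescaled_lap_u0; case: ifP => mk; last first.
  by rewrite mesa_u0_mesa ?mesa_v0_mesa ?ltnNge ?mk//; ring.
rewrite mesa_u0E; have [j ->] := mesa_distS mk.
have root := eta_coefS_root kappa4 j.
transitivity (mesa_v0 k ^+ 2 *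
  (eta_coef kappa j.+1 ^+ 2 - eta_coef kappa j.+1 + eta_coef kappa j / kappa)).
  by rewrite [j.+1.-1]/=; ring.
by rewrite root mulr0.
Qed.

Lemma rescaled_eq_v0 (k : 'I_n) : rescaled_eq_v 0 mesa_u0 mesa_v0 k = 0.
Proof.
rewrite /rescaled_eq_v rescaled_lap_v0; case: ifP => mk; last first.
  by rewrite mesa_dist_mesa ?mesa_u0_mesa ?mesa_v0_mesa ?ltnNge ?mk// expr0; ring.
have [j ->] := mesa_distS mk; rewrite expr0n /= mul0r.
by field; rewrite gt_eqF.
Qed.

(** The linearization of the rescaled equations at the leading-order profile. *)
Definition rescaled_lin_u (a b : 'I_n -> R) (k : 'I_n) : R :=
  rescaled_lap m 0 mesa_u0 k * b k + mesa_v0 k * rescaled_lap m 0 a k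
  + (-1 * (mesa_u0 k * b k + mesa_v0 k * a k) + 2 * mesa_u0 k * a k).
Definition rescaled_lin_v (a b : 'I_n -> R) (k : 'I_n) : R :=
  kappa * rescaled_lap m 0 b k
  + (-1 * b k + 0 ^+ dist k * (2 * mesa_u0 k * a k)).

(** The linearization is triangular with respect to the distance to the mesa. *)
Lemma rescaled_lin_inj (a b : 'I_n -> R) :
  (forall k, rescaled_lin_u a b k = 0) -> (forall k, rescaled_lin_v a b k = 0) ->
  forall k, a k = 0 /\ b k = 0.
Proof.
move=> lu lv.
suff ind D : forall k, (dist k < D)%N -> a k = 0 /\ b k = 0.
  by move=> k; exact: (ind (dist k).+1).
elim: D => [//|D IH] k; rewrite ltnS => kD.
have la : rescaled_lap m 0 a k = 0.
  by apply: rescaled_lap0_eq0 => j jk; have [] := IH j (leq_trans jk kD).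
have lb : rescaled_lap m 0 b k = 0.
  by apply: rescaled_lap0_eq0 => j jk; have [] := IH j (leq_trans jk kD).
have := lu k; have := lv k; rewrite /rescaled_lin_u /rescaled_lin_v la lb.
rewrite rescaled_lap_u0; case: ifP => mk.
  have [j jE] := mesa_distS mk.
  rewrite jE expr0n /= !mul0r mulr0 add0r addr0 mulN1r => /eqP; rewrite oppr_eq0 => /eqP ->.
  rewrite mesa_u0E jE !mulr0 add0r add0r => e.
  split => //.
  have : (mesa_v0 k * (2 * eta_coef kappa j.+1 - 1)) * a k = 0.
    by rewrite -[RHS]e; ring.
  move/eqP; rewrite mulf_eq0 => /orP[|/eqP//].
  rewrite mulf_eq0 gt_eqF ?mesa_v0_gt0// orFb => /eqP h; exfalso.
  by move: (eta_coef kappa j.+1) h (eta_coefS_lt_half kappa4 j) => eta; lra.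
rewrite mesa_dist_mesa ?mesa_u0_mesa ?mesa_v0_mesa ?ltnNge ?mk// expr0 => e1 e2.
by split; lra.
Qed.

Lemma strictly_diff_rescaled_lap (N : nat) (x0 : 'rV[R]_N) (s : 'I_n -> 'I_N) k :
  strictly_diff x0 (fun x d => rescaled_lap m d (fun j => x 0 (s j)) k)
                   (fun h => rescaled_lap m 0 (fun j => h 0 (s j)) k).
Proof.
have dX e : strictly_diff x0 (fun _ d => d ^+ e) (fun=> 0).
  by apply: strictly_diff_cst; exact: exprn_continuous.
have dterm e j := strictly_diffM (dX e) (strictly_diff_coord x0 (s j)).
have dd := strictly_diffZ (- 2) (dterm 1 k).
pose e1 := ((mesa_dist m (ordS k)).+1 - mesa_dist m k)%N.
pose e2 := ((mesa_dist m (ord_pred k)).+1 - mesa_dist m k)%N.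
apply: strictly_diff_ext
  (strictly_diffD (strictly_diffD (dterm e1 (ordS k)) (dterm e2 (ord_pred k))) dd) _ _.
  by move=> x d /=; rewrite /rescaled_lap expr1; ring.
by move=> h /=; rewrite /rescaled_lap -/e1 -/e2; ring.
Qed.

(** The branch of solutions of the rescaled system through the leading-order
    profile. A vector of length [n + n] holds the values of [X], then of [Y]. *)
Lemma mesa_branch : exists X Y : R -> 'I_n -> R,
  [/\ \forall d \near 0, forall k, rescaled_eq_u d (X d) (Y d) k = 0 /\
                                   rescaled_eq_v d (X d) (Y d) k = 0,
      forall k, X d k @[d --> 0] --> mesa_u0 k &
      forall k, Y d k @[d --> 0] --> mesa_v0 k].
Proof.
pose x0 : 'rV[R]_(n + n) := row_mx (\row_k mesa_u0 k) (\row_k mesa_v0 k).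
have x0u k : x0 0 (lshift n k) = mesa_u0 k by rewrite row_mxEl mxE.
have x0v k : x0 0 (rshift n k) = mesa_v0 k by rewrite row_mxEr mxE.
pose xu (x : 'rV[R]_(n + n)) k : R := x 0 (lshift n k).
pose xv (x : 'rV[R]_(n + n)) k : R := x 0 (rshift n k).
have x0uE : (fun k => x0 0 (lshift n k)) = mesa_u0 by apply/funext.
have x0vE : (fun k => x0 0 (rshift n k)) = mesa_v0 by apply/funext.
pose F (i : 'I_(n + n)) (x : 'rV[R]_(n + n)) (d : R) : R := match fintype.split i with
  | inl k => rescaled_eq_u d (xu x) (xv x) k
  | inr k => rescaled_eq_v d (xu x) (xv x) k end.
pose l (i : 'I_(n + n)) (h : 'rV[R]_(n + n)) : R := match fintype.split i with
  | inl k => rescaled_lin_u (xu h) (xv h) k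
  | inr k => rescaled_lin_v (xu h) (xv h) k end.
have dF i : strictly_diff x0 (F i) (l i).
  rewrite /F /l; case: (fintype.split i) => k.
  - have dU := strictly_diff_coord x0 (lshift n k).
    have dV := strictly_diff_coord x0 (rshift n k).
    have dA := strictly_diff_rescaled_lap x0 (@lshift n n) k.
    apply: strictly_diff_ext (strictly_diffD (strictly_diffM dA dV)
      (strictly_diffD (strictly_diffZ (-1) (strictly_diffM dU dV))
                      (strictly_diffM dU dU))) _ _ => // h.
    by rewrite /= x0uE x0u x0v /rescaled_lin_u /xu /xv; ring.
  - have dU := strictly_diff_coord x0 (lshift n k).
    have dV := strictly_diff_coord x0 (rshift n k).
    have dA := strictly_diff_rescaled_lap x0 (@rshift n n) k.
    have dX : strictly_diff x0 (fun _ d => d ^+ dist k) (fun=> 0).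
      by apply: strictly_diff_cst; exact: exprn_continuous.
    apply: strictly_diff_ext (strictly_diffD (strictly_diffZ kappa dA)
      (strictly_diffD (strictly_diffZ (-1) dV)
                      (strictly_diffM dX (strictly_diffM dU dU)))) _ _ => // h.
    by rewrite /= x0u /rescaled_lin_v /xu /xv; ring.
have linj h : (forall i, l i h = 0) -> h = 0.
  move=> lh; have lu k : rescaled_lin_u (xu h) (xv h) k = 0.
    by have := lh (lshift n k); rewrite /l (fintype.unsplitK (inl k)).
  have lv k : rescaled_lin_v (xu h) (xv h) k = 0.
    by have := lh (rshift n k); rewrite /l (fintype.unsplitK (inr k)).
  apply/rowP => i; rewrite mxE -(fintype.splitK i).
  by case: (fintype.split i) => k; have [] := rescaled_lin_inj lu lv k.
have F0 i : F i x0 0 = 0.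
  rewrite /F; case: (fintype.split i) => k; rewrite /xu /xv x0uE x0vE.
    exact: rescaled_eq_u0.
  exact: rescaled_eq_v0.
have [x [Fx x_cvg]] := strict_implicit_function dF linj F0.
exists (fun d => xu (x d)), (fun d => xv (x d)); split.
- apply: filterS Fx => d Fxd k; split.
    by have := Fxd (lshift n k); rewrite /F (fintype.unsplitK (inl k)).
  by have := Fxd (rshift n k); rewrite /F (fintype.unsplitK (inr k)).
- move=> k; rewrite -x0u.
  exact: (cvg_comp _ _ x_cvg (@coord_continuous _ _ _ 0 (lshift n k) x0)).
- move=> k; rewrite -x0v.
  exact: (cvg_comp _ _ x_cvg (@coord_continuous _ _ _ 0 (rshift n k) x0)).
Qed.

End MesaBranch.

(** * Mesa solutions: convergence, stability, leading order *)

Section MesaSolution.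
Variables (R : realType) (n m : nat) (kappa : R).
Hypotheses (hm : (1 <= m)%N) (hmn : (m < n)%N) (kappa4 : 4 < kappa).

Let dist := @mesa_dist n m.
Let kappa0 : 0 < kappa. Proof. exact: lt_trans kappa4. Qed.

Let u0 := @mesa_u0 R n m kappa.
Let v0 := @mesa_v0 R n m kappa.
Let v0_gt0 k : 0 < v0 k := mesa_v0_gt0 m kappa4 k.

Variables X Y : R -> 'I_n -> R.
Hypothesis XY_eq : \forall d \near (0 : R),
  forall k, rescaled_eq_u m d (X d) (Y d) k = 0 /\
            rescaled_eq_v m kappa d (X d) (Y d) k = 0.
Hypothesis X_cvg : forall k, X d k @[d --> (0 : R)] --> u0 k.
Hypothesis Y_cvg : forall k, Y d k @[d --> (0 : R)] --> v0 k.

(* the family of steady states in the original unknowns *)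
Let U (eps : R) k := (eps ^+ 2) ^+ dist k * X (eps ^+ 2) k.
Let V (eps : R) k := (eps ^+ 2) ^+ dist k * Y (eps ^+ 2) k.

Let sq_cvg : eps ^+ 2 @[eps --> (0 : R)^'+] --> (0 : R).
Proof.
apply: cvg_at_right_filter.
by have := @exprn_continuous R 2 0; rewrite /continuous_at expr0n.
Qed.

Let pow_cvg k : (eps ^+ 2) ^+ dist k @[eps --> (0 : R)^'+] --> (0 ^+ dist k : R).
Proof. exact: (cvg_comp _ _ sq_cvg (@exprn_continuous R (dist k) 0)). Qed.

Let Xsq_cvg k : X (eps ^+ 2) k @[eps --> 0^'+] --> u0 k.
Proof.
exact: (@cvg_comp _ _ _ (fun eps : R => eps ^+ 2) (X ^~ k) _ _ _ sq_cvg (@X_cvg k)).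
Qed.

Let Ysq_cvg k : Y (eps ^+ 2) k @[eps --> 0^'+] --> v0 k.
Proof.
exact: (@cvg_comp _ _ _ (fun eps : R => eps ^+ 2) (Y ^~ k) _ _ _ sq_cvg (@Y_cvg k)).
Qed.

(** The factor [0 ^+ dist k] is [1] on the mesa and [0] elsewhere. *)
Lemma mesa_U_cvg k : U eps k @[eps --> 0^'+] --> 0 ^+ dist k * u0 k.
Proof. exact: cvgM. Qed.

Lemma mesa_V_cvg k : V eps k @[eps --> 0^'+] --> 0 ^+ dist k * v0 k.
Proof. exact: cvgM. Qed.

Lemma mesa_ratio_cvg k : U eps k / V eps k @[eps --> 0^'+] --> eta_coef kappa (dist k).
Proof.
have -> : eta_coef kappa (dist k) = u0 k / v0 k.
  by rewrite /u0 mesa_u0E mulfK// gt_eqF.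
have XY : X (eps ^+ 2) k / Y (eps ^+ 2) k @[eps --> 0^'+] --> u0 k / v0 k.
  by apply: cvgM => //; apply: cvgV => //; rewrite gt_eqF.
apply: cvg_trans XY; apply: near_eq_cvg; near=> eps.
have eps0 : 0 < eps by near: eps; exact: nbhs_right_gt.
by rewrite /U /V -mulf_div divff ?mul1r// expf_neq0// gt_eqF// exprn_gt0.
Unshelve. all: by end_near. Qed.

Lemma mesa_V_gt0 : \forall eps \near (0 : R)^'+, forall k, 0 < Y (eps ^+ 2) k.
Proof. by apply: filter_forall => k; exact: (cvgr_gt _ (@Ysq_cvg k)). Qed.

Lemma mesa_branch_solution : mesa_solution m kappa U V.
Proof.
split.
- near=> eps.
  have eps0 : 0 < eps by near: eps; exact: nbhs_right_gt.
  have Y0 : forall k, 0 < Y (eps ^+ 2) k by near: eps; exact: mesa_V_gt0.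
  have E : forall k,
      rescaled_eq_u m (eps ^+ 2) (X (eps ^+ 2)) (Y (eps ^+ 2)) k = 0 /\
      rescaled_eq_v m kappa (eps ^+ 2) (X (eps ^+ 2)) (Y (eps ^+ 2)) k = 0.
    by near: eps; exact: (sq_cvg XY_eq).
  split => [|k]; last by rewrite mulr_gt0// !exprn_gt0.
  by apply: rescaled_steady => // k; have [] := E k.
- move=> k km; have k0 : (dist k) = 0%N by exact: mesa_dist_mesa.
  have := @mesa_U_cvg k; have := @mesa_V_cvg k.
  by rewrite /u0 /v0 mesa_u0_mesa// mesa_v0_mesa// k0 expr0 mulr1.
- move=> k mk; have [j jE] := mesa_distS hm hmn mk.
  have := @mesa_U_cvg k; have := @mesa_V_cvg k.
  by rewrite /dist jE expr0n !mul0r.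
Unshelve. all: by end_near. Qed.

Lemma mesa_branch_stable :
  \forall eps \near (0 : R)^'+, linearly_stable kappa eps (U eps) (V eps).
Proof.
pose mu k eps := -1 + 2 * (U eps k / V eps k)
  - 2 * (U eps k / V eps k) ^+ 2 * U eps k + eps ^+ 2 * (4 + 8 * 2 ^+ 3 * kappa).
have eta_bnd k : 0 < eta_coef kappa (dist k) <= 1 by exact: eta_coef_bounds.
pose L k := -1 + 2 * eta_coef kappa (dist k)
  - 2 * eta_coef kappa (dist k) ^+ 2 * (0 ^+ dist k * u0 k) + 0 * (4 + 8 * 2 ^+ 3 * kappa).
have mu_cvg k : mu k eps @[eps --> 0^'+] --> L k.
  have W := @mesa_ratio_cvg k; have U' := @mesa_U_cvg k.
  apply: cvgD; last by apply: cvgM => //; exact: cvg_cst.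
  apply: cvgB.
    by apply: cvgD; [|apply: cvgM => //]; exact: cvg_cst.
  apply: cvgM => //; apply: cvgM; first exact: cvg_cst.
  exact: (cvgM W W).
have L_lt0 k : L k < 0.
  rewrite /L; have [km|mk] := ltnP k m.
    by rewrite /u0 mesa_u0_mesa// /dist mesa_dist_mesa//= !expr1n expr0; lra.
  have [j jE] := mesa_distS hm hmn mk.
  rewrite /dist jE expr0n.
  by move: (eta_coef kappa j.+1) (eta_coefS_lt_half kappa4 j) => eta /=; lra.
have U_lim k : `|0 ^+ dist k * u0 k| < 2.
  have [km|mk] := ltnP k m.
    by rewrite /u0 mesa_u0_mesa// /dist mesa_dist_mesa// expr0 mul1r normr1 ltr1n.
  by have [j jE] := mesa_distS hm hmn mk; rewrite /dist jE expr0n mul0r normr0.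
have W_lim k : `|eta_coef kappa (dist k)| < 2.
  by have /andP[e0 e1] := eta_bnd k; rewrite gtr0_norm// (le_lt_trans e1)// ltr1n.
have near_mu : \forall eps \near (0 : R)^'+, forall k, mu k eps < 0.
  by apply: filter_forall => k; exact: (cvgr_lt _ (@mu_cvg k)).
have near_U : \forall eps \near (0 : R)^'+, forall k, `|U eps k| < 2.
  by apply: filter_forall => k; exact: (cvgr_norm_lt _ (@mesa_U_cvg k)).
have near_W : \forall eps \near (0 : R)^'+, forall k, `|U eps k / V eps k| < 2.
  by apply: filter_forall => k; exact: (cvgr_norm_lt _ (@mesa_ratio_cvg k)).
near=> eps => lambda eig.
have eps0 : 0 < eps by near: eps; exact: nbhs_right_gt.
have U2 : forall k, `|U eps k| < 2 by near: eps.
have W2 : forall k, `|U eps k / V eps k| < 2 by near: eps.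
have mu0 : forall k, mu k eps < 0 by near: eps.
have [k lek] := lin_eigenvalue_bound kappa0 eps0 (fun k => ltW (U2 k))
  (fun k => ltW (W2 k)) eig.
exact: le_lt_trans lek (mu0 k).
Unshelve. all: by end_near. Qed.

Lemma mesa_branch_leading_order : mesa_leading_order m kappa U V.
Proof.
move=> k; split=> [km|/andP[mk kn]].
  have [_ /(_ k km)[U1 V1] _] := mesa_branch_solution.
  by split; rewrite /asymp; under eq_fun do rewrite divr1.
have [kE pE] := mesa_dist_near hm hmn mk kn.
rewrite /node -kE; split; rewrite /asymp.
  have YV : Y (eps ^+ 2) k / kappa ^+ dist k @[eps --> 0^'+] --> (1 : R).
    rewrite -[1](@divff _ (v0 k)) ?gt_eqF//.
    have -> : v0 k / v0 k = v0 k / kappa ^+ dist k.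
      by rewrite {2}/v0 /mesa_v0 pE mulr1.
    by apply: cvgM => //; exact: cvg_cst.
  apply: cvg_trans YV; apply: near_eq_cvg; near=> eps.
  have eps0 : 0 < eps by near: eps; exact: nbhs_right_gt.
  rewrite /V -/(dist k) [(kappa * _) ^+ _]exprMn [kappa ^+ _ * _]mulrC -mulf_div.
  by rewrite divff ?mul1r// expf_neq0// gt_eqF// exprn_gt0.
have /andP[eta0 _] := eta_coef_bounds kappa4 (dist k).
have W : U eps k / V eps k / eta_coef kappa (dist k) @[eps --> 0^'+] --> (1 : R).
  rewrite -[1](@divff _ (eta_coef kappa (dist k))) ?gt_eqF//.
  by apply: cvgM; [exact: mesa_ratio_cvg|exact: cvg_cst].
apply: cvg_trans W; apply: near_eq_cvg; near=> eps.
by rewrite -[LHS]mulrA -invfM [V eps k * _]mulrC.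
Unshelve. all: by end_near. Qed.

End MesaSolution.

Theorem mainTheorem7 (R : realType) (n m : nat) (kappa : R)
    (hm : (1 <= m)%N) (hmn : (m < n)%N) (hkappa : 0 < kappa) :
  (4 < kappa ->
     exists U V : R -> 'I_n -> R,
       [/\ mesa_solution m kappa U V,
           (\forall eps \near 0^'+,
              linearly_stable kappa eps (U eps) (V eps)) &
           mesa_leading_order m kappa U V])
  /\
  (kappa < 4 -> ~ exists k : 'I_n, jump_solution kappa k).
Proof.
split=> [kappa4|kappa4 [k]]; last exact: no_jump_solution.
have [X [Y [XY_eq X_cvg Y_cvg]]] := mesa_branch hm hmn kappa4.
exists (fun eps k => (eps ^+ 2) ^+ mesa_dist m k * X (eps ^+ 2) k),
       (fun eps k => (eps ^+ 2) ^+ mesa_dist m k * Y (eps ^+ 2) k); split.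
- exact: mesa_branch_solution.
- exact: mesa_branch_stable.
- exact: mesa_branch_leading_order.
Qed.
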